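(* Let $n\ge 3$, let $a,b\in\mathbb{R}$, $p(x,y)=y^2-x^3-ax-b$, and let $\beta=\{\beta_{ij}\}_{i,j\in\mathbb{Z}_+,\,i+j\le 2n}$ be a real bivariate sequence whose moment matrix $M(n)$ is positive semidefinite and $p$-pure, and such that $\beta_{ij}=0$ whenever $j$ is odd. Let $\mathrm{pr}_1:\mathbb{R}^2\to\mathbb{R}$ be the projection to the first coordinate. Define: (1) $\widetilde\beta=\{\widetilde\beta_{ij}\}_{i,j\in\mathbb{Z}_+,\,i+2j\le 2n}$ by $\widetilde\beta_{ij}:=\beta_{i,2j}$, and $\widetilde K:=\{(x,z)\in\mathbb{R}\times[0,\infty): z=x^3+ax+b\}$. (2) $\phi:\mathbb{R}^2\to\mathbb{R}^2$, $\phi(x,z)=(x,z-ax-b)$, and $\widehat\beta=\phi(\widetilde\beta)=\{\widehat\beta_{ij}\}_{i,j\in\mathbb{Z}_+,\,i+2j\le 2n}$, $\widehat\beta_{ij}:=L_{\widetilde\beta}\bigl(x^i(z-ax-b)^j\bigr)$, where $L_{\widetilde\beta}$ is the linear functional with $L_{\widetilde\beta}(x^iz^j)=\widetilde\beta_{ij}$ for $i+2j\le 2n$. Then $\phi(\widetilde K)=\{(x,x^3): x\in\mathrm{pr}_1(\widetilde K)\}$. (3) The univariate sequence $\gamma=\{\gamma_t\}_{0\le t\le 3n}$ by $\gamma_{i+3j}:=\widehat\beta_{ij}$ for $i,j\in\mathbb{Z}_+$, $i+2j\le 2n$. (4) $x_1$, the smallest real root of $x^3+ax+b$; $\widetilde\phi:\mathbb{R}\to\mathbb{R}$,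 $\widetilde\phi(x)=x-x_1$; $\widetilde\gamma=\widetilde\phi(\gamma)=\{\widetilde\gamma_t\}_{0\le t\le 3n}$, $\widetilde\gamma_t:=L_\gamma\bigl((x-x_1)^t\bigr)$, where $L_\gamma$ is the linear functional with $L_\gamma(x^t)=\gamma_t$; and $E:=\widetilde\phi\bigl(\mathrm{pr}_1(\phi(\widetilde K))\bigr)=\widetilde\phi\bigl(\mathrm{pr}_1(\widetilde K)\bigr)$. Equivalently, $E=[0,\infty)$ if $x^3+ax+b$ has exactly one real root $x_1$, and $E=[0,x_2-x_1]\cup[x_3-x_1,\infty)$ if $x^3+ax+b$ has three real roots $x_1<x_2<x_3$. Then the following are equivalent: (i) $\beta$ admits a representing measure supported on $\mathcal{Z}(p)=\{(x,y)\in\mathbb{R}^2:p(x,y)=0\}$. (ii) $\widetilde\gamma$ admits a representing measure supported on $E$. Moreover, given a representing measure for any one of the sequences $\beta$ (on $\mathcal{Z}(p)$), $\widetilde\beta$ (on $\widetilde K$), $\widehat\beta$ (on $\phi(\widetilde K)$), $\gamma$ (on $\mathrm{pr}_1(\phi(\widetilde K))$), $\widetilde\gamma$ (on $E$), one can construct representing measures for all the others via the explicit transformations described in (1)–(4).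
   Context: A representing measure supported on a closed set $K$ for a (uni- or bivariate) truncated sequence is a positive Borel measure with support in $K$ whose moments $\int x^i y^j\,d\mu$ (resp. $\int x^t\,d\mu$) equal the given sequence entries for all indices in the index set of the sequence. Moment matrix: $M(n)$ is the real symmetric matrix with rows and columns indexed by the monomials $x^iy^j$, $i+j\le n$ (columns denoted $X^iY^j$), whose entry in row $x^iy^j$ and column $x^ky^l$ is $\beta_{i+k,j+l}$. A polynomial $q=\sum a_{ij}x^iy^j$ with $\deg q\le n$ is a column relation of $M(n)$ if $\sum a_{ij}X^iY^j=0$. $M(n)$ is $p$-pure if its column relations are exactly those obtained from $p$ by linearity and recursiveness, i.e. exactly the polynomials $pr$ with $r\in\mathbb{R}[x,y]$, $\deg(pr)\le n$. *)

(* Defs.v *)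
From HB Require Import structures.
From mathcomp Require Import all_boot all_order all_algebra.
From mathcomp Require Import all_classical all_reals all_analysis.
Import Order.TTheory GRing.Theory Num.Theory.
Import numFieldNormedType.Exports.

Set Implicit Arguments.
Unset Strict Implicit.
Unset Printing Implicit Defensive.

Local Open Scope classical_set_scope.
Local Open Scope ring_scope.

(* R[x, y] is {poly {poly R}} with the conventions of polyXY: 'X is x, 'Y is y
   (also written z below), q`_i`_j is the coefficient of x^i y^j and q.[x, y]
   is evaluation.  Truncated sequences are functions on nat (or on pairs of nat)
   of which only the entries in the relevant index set are ever constrained or
   used. *)

Section TruncatedSequences.
Variable R : realType.

Definition deg_index (n : nat) : rel nat := [rel i j | (i + j <= 2 * n)%N].
Definition weighted_index (n : nat) : rel nat :=
  [rel i j | (i + 2 * j <= 2 * n)%N].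

Definition riesz (s : nat -> R) (q : {poly R}) : R :=
  \sum_(t < size q) q`_t * s t.

Definition riesz2 (s : nat -> nat -> R) (q : {poly {poly R}}) : R :=
  \sum_(i < size q) \sum_(j < size q`_i) q`_i`_j * s i j.

Definition deg_le (d : nat) (q : {poly {poly R}}) : Prop :=
  forall i j : nat, q`_i`_j != 0 -> (i + j <= d)%N.

(* (i, j) with i + j <= n, standing for the monomial x^i y^j *)
Definition monomial (n : nat) :=
  {m : 'I_n.+1 * 'I_n.+1 | (m.1 + m.2 <= n)%N}.

Definition xexp n (r : 'I_#|{: monomial n}|) : nat := (val (enum_val r)).1.
Definition yexp n (r : 'I_#|{: monomial n}|) : nat := (val (enum_val r)).2.

Definition moment_matrix n (s : nat -> nat -> R) :
    'M[R]_#|{: monomial n}| :=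
  \matrix_(r, c) s (xexp r + xexp c)%N (yexp r + yexp c)%N.

Definition psd m (A : 'M[R]_m) : Prop :=
  A^T = A /\ forall v : 'cV[R]_m, 0 <= (v^T *m A *m v) 0 0.

Definition column_relation n (s : nat -> nat -> R) (q : {poly {poly R}}) :
    Prop :=
  deg_le n q /\
  \sum_(c < #|{: monomial n}|)
     q`_(xexp c)`_(yexp c) *: col c (moment_matrix n s) = 0.

Definition p_pure n (s : nat -> nat -> R) (p : {poly {poly R}}) : Prop :=
  forall q : {poly {poly R}},
    column_relation n s q <->
    exists r : {poly {poly R}}, q = p * r /\ deg_le n (p * r).

End TruncatedSequences.

Section RepresentingMeasures.
Local Open Scope ereal_scope.
Variable R : realType.

Definition msupport (T : topologicalType) (mu : set T -> \bar R) : set T :=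
  [set x | forall U : set T, open U -> U x -> 0 < mu U].

Definition represents (N : nat) (s : nat -> R) (K : set R)
    (mu : {measure set R -> \bar R}) : Prop :=
  msupport mu `<=` K /\
  forall t : nat, (t <= N)%N ->
    mu.-integrable setT (fun x => (x ^+ t)%:E) /\
    \int[mu]_x (x ^+ t)%:E = (s t)%:E.

(* The product sigma-algebra on R * R is the Borel one. *)
Definition represents2 (I : rel nat) (s : nat -> nat -> R) (K : set (R * R))
    (mu : {measure set (R * R) -> \bar R}) : Prop :=
  msupport mu `<=` K /\
  forall i j : nat, I i j ->
    mu.-integrable setT (fun u : R * R => (u.1 ^+ i * u.2 ^+ j)%:E) /\
    \int[mu]_u (u.1 ^+ i * u.2 ^+ j)%:E = (s i j)%:E.

Definition is_pushforward d1 d2 (T1 : measurableType d1)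
    (T2 : measurableType d2) (f : T1 -> T2)
    (mu : {measure set T1 -> \bar R}) (nu : {measure set T2 -> \bar R}) :
    Prop :=
  forall A : set T2, measurable A -> nu A = pushforward mu f A.

(* mu is the average of the images of nu under (x, z) |-> (x, sqrt z) and
   (x, z) |-> (x, - sqrt z): the measure invariant under y |-> - y whose image
   under (x, y) |-> (x, y^2) is nu, for nu carried by {z >= 0}. *)
Definition is_symmetric_lift (nu mu : {measure set (R * R) -> \bar R}) :
    Prop :=
  forall A : set (R * R), measurable A ->
    mu A = (2^-1)%:E *
      (pushforward nu (fun u : R * R => (u.1, Num.sqrt u.2)) A +
       pushforward nu (fun u : R * R => (u.1, (- Num.sqrt u.2)%R)) A).

End RepresentingMeasures.

Section Construction.
Variables (R : realType) (a b : R).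

Definition cubic : {poly R} := 'X^3 + a *: 'X + b%:P.

Definition curve_poly : {poly {poly R}} :=
  'Y ^+ 2 - 'X^3 - a%:P%:P * 'X - b%:P%:P.

Definition curve : set (R * R) := [set u | curve_poly.[u.1, u.2] = 0].

Definition beta_tilde (beta : nat -> nat -> R) (i j : nat) : R :=
  beta i (2 * j)%N.

Definition K_tilde : set (R * R) :=
  [set u | 0 <= u.2 /\ u.2 = u.1 ^+ 3 + a * u.1 + b].

Definition phi (u : R * R) : R * R := (u.1, u.2 - a * u.1 - b).
Definition phi_inv (u : R * R) : R * R := (u.1, u.2 + a * u.1 + b).

Definition beta_hat (beta : nat -> nat -> R) (i j : nat) : R :=
  riesz2 (beta_tilde beta) ('X^i * ('Y - a%:P%:P * 'X - b%:P%:P) ^+ j).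

(* gamma_(i + 3 j) := beta_hat_(i, j), read off at the representation of t with
   i < 3; independence of the representation is part of the theorem. *)
Definition gamma (beta : nat -> nat -> R) (t : nat) : R :=
  beta_hat beta (t %% 3)%N (t %/ 3)%N.

Definition smallest_root (x1 : R) : Prop :=
  root cubic x1 /\ forall x : R, root cubic x -> x1 <= x.

Definition phi_tilde (x1 x : R) : R := x - x1.

Definition gamma_tilde (x1 : R) (beta : nat -> nat -> R) (t : nat) : R :=
  riesz (gamma beta) (('X - x1%:P) ^+ t).

Definition E_set (x1 : R) : set R :=
  phi_tilde x1 @` (fst @` (phi @` K_tilde)).

End Construction.

(* Main.v *)
(** Purity makes every product of the cubic with a monomial of degree at most
[2n - 3] lie in the kernel of the Riesz functional of [beta], because such a
monomial splits as one of degree at most [n - 3] times one of degree at most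
[n]; hence [beta_hat] depends on [(i, j)] only through [i + 3 j].  A measure is
supported on a closed set iff the complement is null, so support conditions and
moments can be followed through each change of variables.  Going back from
[z = y^2] to [y], the measure is split evenly between the two square roots; the
odd moments then cancel, provided they exist, which follows from the even ones
by AM-GM. *)

Require Import Defs.
From HB Require Import structures.
From mathcomp Require Import all_boot all_order all_algebra.
From mathcomp Require Import all_classical all_reals all_analysis.
From mathcomp Require Import measurable_realfun.
From mathcomp Require Import ring lra zify.
Import Order.TTheory GRing.Theory Num.Theory.
Import numFieldNormedType.Exports.
Local Open Scope classical_set_scope.
Local Open Scope ring_scope.

Set Implicit Arguments.
Unset Strict Implicit.
Unset Printing Implicit Defensive.

(** * Riesz functionals and the relations given by purity *)

(** [riesz s] sums up to the size of its argument, which addition may change; padding with zero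
    coefficients to a common length makes linearity termwise. *)
Lemma riesz_wide (R : realType) (s : nat -> R) (N : nat) (q : {poly R}) :
  (size q <= N)%N -> riesz s q = \sum_(t < N) q`_t * s t.
Proof.
move=> qN; rewrite /riesz (big_ord_widen N (fun t => q`_t * s t) qN) big_mkcond.
apply: eq_bigr => t _; case: ltnP => // /(nth_default 0) ->.
by rewrite mul0r.
Qed.

Lemma rieszD (R : realType) (s : nat -> R) (p q : {poly R}) :
  riesz s (p + q) = riesz s p + riesz s q.
Proof.
set N := maxn (size p) (size q).
rewrite !(@riesz_wide _ _ N) ?size_polyD ?leq_maxl ?leq_maxr// -big_split/=.
by apply: eq_bigr => t _; rewrite coefD mulrDl.
Qed.

Lemma rieszZ (R : realType) (s : nat -> R) (c : R) (q : {poly R}) :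
  riesz s (c *: q) = c * riesz s q.
Proof.
rewrite !(@riesz_wide _ _ (size q)) ?size_scale_leq// mulr_sumr.
by apply: eq_bigr => t _; rewrite coefZ mulrA.
Qed.

Lemma riesz0 (R : realType) (s : nat -> R) : riesz s 0 = 0.
Proof. by rewrite -(scale0r 0) rieszZ mul0r. Qed.

Lemma rieszXn (R : realType) (s : nat -> R) (t : nat) : riesz s 'X^t = s t.
Proof.
rewrite (@riesz_wide _ _ t.+1) ?size_polyXn// big_ord_recr/= coefXn eqxx mul1r.
rewrite big1 ?add0r// => k _; rewrite coefXn.
by rewrite (ltn_eqF (ltn_ord k)) mul0r.
Qed.

Lemma poly_linear_ind (R : realType) (N : nat) (P : {poly R} -> Prop) :
  P 0 -> (forall p q, P p -> P q -> P (p + q)) ->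
  (forall c t, (t <= N)%N -> P (c *: 'X^t)) ->
  forall q : {poly R}, (size q <= N.+1)%N -> P q.
Proof.
move=> P0 PD PX q qN; rewrite -(coefK q) poly_def.
apply: (big_ind P) => // t _; apply: PX.
by rewrite -ltnS (leq_trans (ltn_ord t)).
Qed.

(** * Monomials of [R[x, y]], the bivariate Riesz functional and weighted degrees *)

Definition support_in (R : realType) (I : nat -> nat -> Prop)
    (q : {poly {poly R}}) : Prop :=
  forall i j : nat, q`_i`_j != 0 -> I i j.

(** The outer variable is x, so y^j enters as the constant [('X^j)%:P], a form whose coefficients
    are read off directly. *)
Definition monom (R : realType) (i j : nat) : {poly {poly R}} :=
  'X^i * ('X^j)%:P.

Lemma monomE (R : realType) (i j : nat) :
  'X^i * 'Y ^+ j = monom R i j.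
Proof. by rewrite /monom rmorphXn. Qed.

Lemma coef_monom (R : realType) (i j k l : nat) :
  (monom R i j)`_k`_l = ((k == i) && (l == j))%:R.
Proof.
rewrite /monom coefMC coefXn; case: (k == i); last by rewrite mul0r coef0.
by rewrite mul1r coefXn.
Qed.

Lemma monomM (R : realType) (i j k l : nat) :
  monom R i j * monom R k l = monom R (i + k) (j + l).
Proof. by rewrite /monom !exprD polyCM; ring. Qed.

Lemma bipoly_linear_ind (R : realType) (I : nat -> nat -> Prop)
    (P : {poly {poly R}} -> Prop) :
  P 0 -> (forall p q, P p -> P q -> P (p + q)) ->
  (forall c i j, I i j -> P (c%:P%:P * monom R i j)) ->
  forall q, support_in I q -> P q.
Proof.
move=> P0 PD PX q qI; rewrite -(coefK q) poly_def.
apply: (big_ind P) => // i _.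
rewrite -[q`_i]coefK poly_def scaler_suml.
apply: (big_ind P) => // j _.
(* Only a nonzero coefficient provides the [I i j] required by [PX]; zero coefficients fall under
   [P 0]. *)
have [->|cij] := eqVneq q`_i`_j 0; first by rewrite !scale0r.
suff -> : q`_i`_j *: 'X^j *: 'X^i = (q`_i`_j)%:P%:P * monom R i j.
  exact/PX/qI.
by rewrite /monom -!mul_polyC polyCM; ring.
Qed.

Lemma riesz2_wide (R : realType) (s : nat -> nat -> R) (N : nat)
    (q : {poly {poly R}}) :
  support_in (fun i j => (i < N)%N && (j < N)%N) q ->
  riesz2 s q = \sum_(i < N) \sum_(j < N) q`_i`_j * s i j.
Proof.
move=> qN.
have inner i : \sum_(j < size q`_i) q`_i`_j * s i j =
    \sum_(j < N) q`_i`_j * s i j.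
  apply: riesz_wide; apply/leq_sizeP => j Nj; apply/eqP.
  by apply: contraTT Nj => /qN; rewrite -ltnNge => /andP[].
rewrite /riesz2; under eq_bigr do rewrite inner.
(* [N] and [size q] are both compared with their maximum, since the terms beyond either bound
   vanish. *)
pose N' := maxn N (size q).
have widen M : (M <= N')%N -> (forall i j, (M <= i)%N -> q`_i`_j = 0) ->
    \sum_(i < M) \sum_(j < N) q`_i`_j * s i j =
    \sum_(i < N') \sum_(j < N) q`_i`_j * s i j.
  move=> MN' q0.
  rewrite (big_ord_widen N' (fun i => \sum_(j < N) q`_i`_j * s i j) MN').
  rewrite big_mkcond; apply: eq_bigr => i _; case: ltnP => // Mi.
  by rewrite big1// => j _; rewrite q0// mul0r.
rewrite (widen (size q)) ?leq_maxr//; last first.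
  by move=> i j qi; rewrite (nth_default 0 qi) coef0.
rewrite (widen N) ?leq_maxl// => i j Ni; apply/eqP.
by apply: contraTT Ni => /qN; rewrite -ltnNge => /andP[].
Qed.

Lemma support_bound (R : realType) (q : {poly {poly R}}) :
  exists N0, forall N, (N0 <= N)%N ->
    support_in (fun i j => (i < N)%N && (j < N)%N) q.
Proof.
exists (maxn (size q) (sizeY q)) => N; rewrite geq_max => /andP[qN qyN] i j.
move=> qij0; apply/andP; split.
  rewrite (leq_trans _ qN)// ltnNge; apply: contraNN qij0.
  by move=> qi; rewrite (nth_default 0 qi) coef0.
rewrite (leq_trans _ qyN)// ltnNge; apply: contraNN qij0 => qj.
by rewrite nth_default// (leq_trans (max_size_coefXY q i) qj).
Qed.

Lemma riesz2D (R : realType) (s : nat -> nat -> R) (p q : {poly {poly R}}) :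
  riesz2 s (p + q) = riesz2 s p + riesz2 s q.
Proof.
have [N1 HN1] := support_bound p; have [N2 HN2] := support_bound q.
have [N3 HN3] := support_bound (p + q).
pose N := maxn N1 (maxn N2 N3).
rewrite !(@riesz2_wide _ _ N); [|apply: HN2|apply: HN1|apply: HN3]; try lia.
rewrite -big_split/=; apply: eq_bigr => i _.
by rewrite -big_split/=; apply: eq_bigr => j _; rewrite !coefD mulrDl.
Qed.

Lemma riesz2Z (R : realType) (s : nat -> nat -> R) (c : R)
    (q : {poly {poly R}}) :
  riesz2 s (c%:P%:P * q) = c * riesz2 s q.
Proof.
have [N1 HN1] := support_bound q; have [N2 HN2] := support_bound (c%:P%:P * q).
rewrite !(@riesz2_wide _ _ (maxn N1 N2)); [|apply: HN1|apply: HN2]; try lia.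
rewrite mulr_sumr; apply: eq_bigr => i _.
by rewrite mulr_sumr; apply: eq_bigr => j _; rewrite !coefCM mulrA.
Qed.

Lemma riesz20 (R : realType) (s : nat -> nat -> R) : riesz2 s 0 = 0.
Proof. by rewrite -[X in riesz2 s X](mul0r 0) -!polyC0 riesz2Z mul0r. Qed.

Lemma riesz2N (R : realType) (s : nat -> nat -> R) (q : {poly {poly R}}) :
  riesz2 s (- q) = - riesz2 s q.
Proof. by apply/eqP; rewrite -addr_eq0 -riesz2D addNr riesz20. Qed.

Lemma riesz2_monom (R : realType) (s : nat -> nat -> R) (i j : nat) :
  riesz2 s (monom R i j) = s i j.
Proof.
set N := (i + j).+1.
rewrite (@riesz2_wide _ _ N); last first.
  move=> k l; rewrite coef_monom pnatr_eq0 eqb0 negbK => /andP[/eqP-> /eqP->].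
  by rewrite !ltnS leq_addl leq_addr.
have iN : (i < N)%N by rewrite ltnS leq_addr.
have jN : (j < N)%N by rewrite ltnS leq_addl.
rewrite (bigD1 (Ordinal iN))//= (bigD1 (Ordinal jN))//=.
rewrite coef_monom !eqxx mul1r big1 ?addr0; last first.
  move=> l; rewrite -val_eqE/= => /negPf lj.
  by rewrite coef_monom lj andbF mul0r.
rewrite big1 ?addr0// => k; rewrite -val_eqE/= => /negPf ki.
by rewrite big1// => l _; rewrite coef_monom ki mul0r.
Qed.

(** The moments of the Dirac mass at a point give evaluation there as Riesz functional, so the
    linearity rules for [riesz2] also compute values of polynomials. *)
Lemma riesz2_horner (R : realType) (q : {poly {poly R}}) (x y : R) :
  q.[x, y] = riesz2 (fun i j => x ^+ i * y ^+ j) q.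
Proof.
rewrite /riesz2 [q.[x%:P]]horner_coef horner_sum; apply: eq_bigr => i _.
rewrite !hornerE horner_coef mulr_suml; apply: eq_bigr => j _.
by rewrite -mulrA; congr (_ * _); rewrite mulrC.
Qed.

(** Weight [w = 1] is total degree; [w = 2] counts z as y^2 and matches [weighted_index]. *)
Definition wdeg_le (R : realType) (w d : nat) (q : {poly {poly R}}) : Prop :=
  support_in (fun i j => (i + w * j <= d)%N) q.

Lemma deg_leE (R : realType) (d : nat) (q : {poly {poly R}}) :
  deg_le d q <-> wdeg_le 1 d q.
Proof. by split=> H i j /H; rewrite mul1n. Qed.

Lemma wdeg_leW (R : realType) (w d e : nat) (q : {poly {poly R}}) :
  (d <= e)%N -> wdeg_le w d q -> wdeg_le w e q.
Proof. by move=> de qd i j /qd /leq_trans; apply. Qed.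

Lemma wdeg_leD (R : realType) (w d : nat) (p q : {poly {poly R}}) :
  wdeg_le w d p -> wdeg_le w d q -> wdeg_le w d (p + q).
Proof.
move=> pd qd i j; rewrite !coefD.
have [->|/pd//] := eqVneq p`_i`_j 0; rewrite add0r; exact: qd.
Qed.

Lemma wdeg_leN (R : realType) (w d : nat) (q : {poly {poly R}}) :
  wdeg_le w d q -> wdeg_le w d (- q).
Proof. by move=> qd i j; rewrite !coefN oppr_eq0; exact: qd. Qed.

Lemma wdeg_leM (R : realType) (w d e : nat) (p q : {poly {poly R}}) :
  wdeg_le w d p -> wdeg_le w e q -> wdeg_le w (d + e) (p * q).
Proof.
move=> pd qe i j pq0; rewrite leqNgt; apply: contra_neqN pq0 => ij.
(* Every term of the double convolution has a vanishing factor: if both were nonzero, their weights,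
   which add up to [i + w * j], would total at most [d + e]. *)
rewrite coefM coef_sum big1// => k _; rewrite coefM big1// => l _.
apply/eqP; rewrite mulf_eq0; apply: contraLR ij.
rewrite negb_or -leqNgt => /andP[/pd + /qe].
have := ltn_ord k; have := ltn_ord l; rewrite !ltnS => lj ki kd ie.
have -> : (i + w * j = (k + w * l) + (i - k + w * (j - l)))%N.
  by rewrite -{1}(subnKC ki) -{1}(subnKC lj) mulnDr addnACA.
exact: leq_add.
Qed.

Lemma wdeg_leX (R : realType) (w d k : nat) (q : {poly {poly R}}) :
  wdeg_le w d q -> wdeg_le w (k * d) (q ^+ k).
Proof.
move=> qd; elim: k => [|k IH].
  rewrite expr0 => i j; rewrite !coef1.
  by case: i j => [|i] [|j]; rewrite ?coef1 ?coef0 ?eqxx// muln0.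
by rewrite exprS mulSn; exact: wdeg_leM.
Qed.

Lemma wdeg_leC (R : realType) (w d : nat) (c : R) : wdeg_le w d c%:P%:P.
Proof.
move=> [|i] j; rewrite coefC/= ?coef0 ?eqxx//.
by case: j => [|j]; rewrite coefC/= ?eqxx// muln0.
Qed.

Lemma wdeg_le_monom (R : realType) (w i j : nat) :
  wdeg_le w (i + w * j) (monom R i j).
Proof.
by move=> k l; rewrite coef_monom pnatr_eq0 eqb0 negbK => /andP[/eqP-> /eqP->].
Qed.

(** * The cubic and the recurrence that purity imposes on [beta] *)

Lemma monomX (R : realType) i : monom R i 0 = 'X^i.
Proof. by rewrite /monom expr0 mulr1. Qed.

Lemma monomY (R : realType) : monom R 0 1 = 'Y.
Proof. by rewrite /monom expr0 mul1r. Qed.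

Lemma curve_polyE (R : realType) (a b : R) :
  curve_poly a b = monom R 0 2 - monom R 3 0 - a%:P%:P * monom R 1 0
                   - b%:P%:P * monom R 0 0.
Proof. by rewrite /curve_poly !monomX -monomE expr0 mul1r mulr1. Qed.

Lemma wdeg_le_curve (R : realType) (a b : R) : wdeg_le 1 3 (curve_poly a b).
Proof.
have mon i j : (i + 1 * j <= 3)%N -> wdeg_le 1 3 (monom R i j).
  by move=> /wdeg_leW; apply; exact: wdeg_le_monom.
rewrite curve_polyE; apply: wdeg_leD; last first.
  by apply/wdeg_leN/(@wdeg_leM _ 1 0 3); [exact: wdeg_leC|exact: mon].
apply: wdeg_leD; last first.
  by apply/wdeg_leN/(@wdeg_leM _ 1 0 3); [exact: wdeg_leC|exact: mon].
by apply: wdeg_leD; [exact: mon|apply: wdeg_leN; exact: mon].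
Qed.

Lemma riesz2_curve (R : realType) (a b : R) (s : nat -> nat -> R) i j :
  riesz2 s (curve_poly a b * monom R i j) =
  s i j.+2 - s i.+3 j - a * s i.+1 j - b * s i j.
Proof.
rewrite curve_polyE !mulrBl -(mulrA a%:P%:P) -(mulrA b%:P%:P) !monomM.
by rewrite !(riesz2D, riesz2N, riesz2Z, riesz2_monom).
Qed.

(** The row indexed by x^k y^l, paired with the coefficients of [q], is the Riesz functional of [s]
    at x^k y^l [q]. *)
Lemma column_relation_riesz2 (R : realType) (n : nat) (s : nat -> nat -> R)
    (q : {poly {poly R}}) (k l : nat) :
  column_relation n s q -> (k + l <= n)%N ->
  riesz2 (fun i j => s (k + i)%N (l + j)%N) q = 0.
Proof.
move=> [qn rel] kln.
have kn : (k < n.+1)%N by lia.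
have ln : (l < n.+1)%N by lia.
pose m : {: monomial n} := exist _ (Ordinal kn, Ordinal ln) kln.
have := congr1 (fun A : 'cV[R]_#|{: monomial n}| => A (enum_rank m) 0) rel.
rewrite summxE mxE => rel0.
rewrite -[RHS]rel0 (@riesz2_wide _ _ n.+1); last first.
  by move=> i j /qn; lia.
pose F (c : monomial n) := q`_(val c).1`_(val c).2 *
  s (k + (val c).1)%N (l + (val c).2)%N.
transitivity (\sum_(c in {: monomial n}) F c); last first.
  rewrite big_enum_val; apply: eq_bigr => c _.
  by rewrite !mxE /xexp /yexp enum_rankK.
(* The columns form a triangle inside the square of side [n.+1]; extending the sum to the square
   adds only zeros because [q] has degree at most [n]. *)
pose G (c : 'I_n.+1 * 'I_n.+1) := q`_c.1`_c.2 * s (k + c.1)%N (l + c.2)%N.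
pose A (c : 'I_n.+1 * 'I_n.+1) := (c.1 + c.2 <= n)%N.
rewrite pair_big/= -(big_sub_cond A predT G).
rewrite big_mkcondl; apply: eq_bigr => c _; rewrite /G unfold_in /=.
case: ifPn => // cn; apply/eqP; rewrite mulf_eq0; apply/orP; left.
by apply: contraNT cn => /qn.
Qed.

Lemma pure_recurrence (R : realType) (n : nat) (a b : R)
    (beta : nat -> nat -> R) :
  (3 <= n)%N -> p_pure n beta (curve_poly a b) ->
  forall i j, (i + j + 3 <= 2 * n)%N ->
    beta i j.+2 = beta i.+3 j + a * beta i.+1 j + b * beta i j.
Proof.
move=> n3 pure i j ijn.
(* Greedy split: [i1] and then [j1] take as much of the exponents as total degree [n - 3] allows,
   which leaves a cofactor of degree at most [n] to index the row. *)
pose i1 := minn i (n - 3); pose j1 := minn j (n - 3 - i1).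
pose q := curve_poly a b * monom R i1 j1.
have rel : column_relation n beta q.
  apply/pure; exists (monom R i1 j1); split=> //; apply/deg_leE.
  apply: wdeg_leW; last first.
    apply: wdeg_leM; first exact: wdeg_le_curve.
    exact: wdeg_le_monom.
  by rewrite /i1 /j1; lia.
have ijn2 : ((i - i1) + (j - j1) <= n)%N by rewrite /i1 /j1; lia.
have := column_relation_riesz2 rel ijn2; rewrite riesz2_curve !addnS !subnK.
- by lra.
- by rewrite /j1; lia.
- by rewrite /i1; lia.
Qed.

(** * The change of variable z - a x - b and the consistency of [gamma] *)

Section Substitution.
Variables (R : realType) (a b : R).

Let w : {poly {poly R}} := 'Y - a%:P%:P * 'X - b%:P%:P.

Let u : {poly {poly R}} := 'X - (a *: 'X + b%:P)%:P.

(* [q(x, y - a x - b)]; the swaps are there because [\Po] substitutes for the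
   outer variable, which is [x]. *)
Definition subst_Y (q : {poly {poly R}}) : {poly {poly R}} :=
  swapXY (swapXY q \Po u).

Lemma subst_YD p q : subst_Y (p + q) = subst_Y p + subst_Y q.
Proof. by rewrite /subst_Y rmorphD/= comp_polyD rmorphD. Qed.

Lemma subst_YM p q : subst_Y (p * q) = subst_Y p * subst_Y q.
Proof. by rewrite /subst_Y rmorphM/= comp_polyM rmorphM. Qed.

Lemma subst_YC (c : R) : subst_Y c%:P%:P = c%:P%:P.
Proof.
by rewrite /subst_Y swapXY_polyC map_polyC comp_polyC swapXY_polyC map_polyC.
Qed.

Lemma subst_YX k p : subst_Y (p ^+ k) = subst_Y p ^+ k.
Proof.
elim: k => [|k IH]; first by rewrite !expr0 -!polyC1 subst_YC.
by rewrite !exprS subst_YM IH.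
Qed.

Lemma subst_Y_X : subst_Y 'X = 'X.
Proof. by rewrite /subst_Y swapXY_X comp_polyC swapXY_Y. Qed.

Lemma subst_Y_Y : subst_Y 'Y = w.
Proof.
rewrite /subst_Y swapXY_Y comp_polyX /u rmorphB/= swapXY_X swapXY_polyC.
by rewrite rmorphD/= map_polyZ/= map_polyX map_polyC/= -mul_polyC opprD addrA.
Qed.

Variable beta : nat -> nat -> R.

(** Both sides are linear in [q], and on monomials the equality is the definition of [beta_hat]. *)
Lemma riesz2_beta_hat q :
  riesz2 (beta_hat a b beta) q = riesz2 (beta_tilde beta) (subst_Y q).
Proof.
apply: (@bipoly_linear_ind _ (fun _ _ => True)
  (fun q => riesz2 (beta_hat a b beta) q =
            riesz2 (beta_tilde beta) (subst_Y q))) => //.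
- by rewrite -!polyC0 subst_YC riesz20 polyC0 riesz20.
- by move=> p r; rewrite subst_YD !riesz2D => -> ->.
- move=> c i j _; rewrite subst_YM subst_YC !riesz2Z riesz2_monom.
  by rewrite -monomE subst_YM !subst_YX subst_Y_X subst_Y_Y.
Qed.

(** The substitutions z - a x - b and z + a x + b are mutually inverse, so the passage to [beta_hat]
    loses nothing. *)
Lemma riesz2_beta_hat_inv i j :
  riesz2 (beta_hat a b beta) ('X^i * ('Y + a%:P%:P * 'X + b%:P%:P) ^+ j) =
  beta_tilde beta i j.
Proof.
rewrite riesz2_beta_hat subst_YM !subst_YX !subst_YD subst_YM !subst_YC.
rewrite subst_Y_X subst_Y_Y.
have -> : w + a%:P%:P * 'X + b%:P%:P = 'Y by rewrite /w; ring.
by rewrite monomE riesz2_monom.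
Qed.

(** Since a x + b has weight at most 1 and z has weight 2, the change of variable never leaves the
    weighted index set. *)
Lemma wdeg_le_w : wdeg_le 2 2 w.
Proof.
have mon i j : (i + 2 * j <= 2)%N -> wdeg_le 2 2 (monom R i j).
  by move=> /wdeg_leW; apply; exact: wdeg_le_monom.
rewrite /w -monomY -['X]/('X^1) -monomX.
apply: wdeg_leD; last by apply: wdeg_leN; exact: wdeg_leC.
apply: wdeg_leD; first exact: mon.
by apply/wdeg_leN/(@wdeg_leM _ 2 0 2); [exact: wdeg_leC|exact: mon].
Qed.

(** The polynomial [w - 'X^3] is the cubic with y^2 read as z, so the functional of [beta_tilde]
    kills its low-weight multiples; the multiplier ['X^i * w ^+ j] gives the claim. *)
Lemma beta_hat_shift n : (3 <= n)%N -> p_pure n beta (curve_poly a b) ->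
  forall i j, (i + 2 * j + 3 <= 2 * n)%N ->
  beta_hat a b beta i.+3 j = beta_hat a b beta i j.+1.
Proof.
move=> n3 pure i j ijn.
have rec := pure_recurrence n3 pure.
suff H q : support_in (fun k l => (k + 2 * l <= 2 * n - 3)%N) q ->
    riesz2 (beta_tilde beta) (q * (w - 'X^3)) = 0.
  apply/eqP; rewrite eq_sym -subr_eq0 -riesz2N -riesz2D; apply/eqP.
  rewrite -[RHS](H ('X^i * w ^+ j)).
    congr riesz2; rewrite -/w -addn3 exprD exprSr; ring.
  rewrite -monomX; apply: wdeg_leW; last first.
    by apply: wdeg_leM; [exact: wdeg_le_monom|apply/wdeg_leX/wdeg_le_w].
  by lia.
move: q; apply: (bipoly_linear_ind
  (P := fun q => riesz2 (beta_tilde beta) (q * (w - 'X^3)) = 0)).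
- by rewrite mul0r riesz20.
- by move=> p r Hp Hr; rewrite mulrDl riesz2D Hp Hr addr0.
move=> c k l kl; rewrite -mulrA riesz2Z.
have -> : w - 'X^3 = monom R 0 1 - a%:P%:P * monom R 1 0
    - b%:P%:P * monom R 0 0 - monom R 3 0.
  by rewrite monomY !monomX expr0 expr1 mulr1.
rewrite !mulrBr (mulrCA _ a%:P%:P) (mulrCA _ b%:P%:P) !monomM.
rewrite !(riesz2D, riesz2N, riesz2Z, riesz2_monom) /beta_tilde.
(* The recurrence is applied at exponents [k] and [2 * l], because z^l stands for y^(2 l). *)
rewrite !addn0 !addn1 addn3 mulnS add2n rec; last by lia.
by rewrite (_ : _ - _ - _ - _ = 0) ?mulr0//; ring.
Qed.

(** Three factors x are traded for one z, [i %/ 3] times, until the x-exponent is below 3. Each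
    trade lowers the weight by one, so every intermediate index stays admissible. *)
Lemma gammaE n : (3 <= n)%N -> p_pure n beta (curve_poly a b) ->
  forall i j, (i + 2 * j <= 2 * n)%N ->
  gamma a b beta (i + 3 * j)%N = beta_hat a b beta i j.
Proof.
move=> n3 pure i j ijn; rewrite /gamma (addnC i) (mulnC 3) modnMDl divnMDl//.
rewrite [in RHS](divn_eq i 3); move: ijn; rewrite {1}(divn_eq i 3).
elim: (i %/ 3)%N j => [|q IH] j ijn; first by rewrite mul0n add0n addn0.
rewrite addnS -addSn IH; last by lia.
by rewrite mulSn -addnA add3n (@beta_hat_shift n)//; lia.
Qed.

End Substitution.

(** By linear extension [gamma_tilde] acts as [gamma] after composition with ['X - x1%:P], and the
    two translations cancel. *)
Lemma riesz_gamma_tilde_inv (R : realType) (a b x1 : R)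
    (beta : nat -> nat -> R) (t : nat) :
  riesz (gamma_tilde a b x1 beta) (('X + x1%:P) ^+ t) = gamma a b beta t.
Proof.
have H q : riesz (gamma_tilde a b x1 beta) q =
    riesz (gamma a b beta) (q \Po ('X - x1%:P)).
  apply: (@poly_linear_ind _ (size q)
    (fun q => riesz (gamma_tilde a b x1 beta) q =
              riesz (gamma a b beta) (q \Po ('X - x1%:P)))); last exact: leqnSn.
  - by rewrite comp_poly0 !riesz0.
  - by move=> p r Hp Hr; rewrite comp_polyD !rieszD Hp Hr.
  - by move=> c k _; rewrite comp_polyZ comp_Xn_poly !rieszZ rieszXn.
rewrite H rmorphXn/= comp_polyD comp_polyX comp_polyC addrNK rieszXn.
by [].
Qed.

Lemma root_cubic (R : realType) (a b x : R) :
  root (cubic a b) x = (x ^+ 3 + a * x + b == 0).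
Proof. by rewrite /cubic rootE !hornerE. Qed.

Lemma horner_curve (R : realType) (a b x y : R) :
  (curve_poly a b).[x, y] = y ^+ 2 - (x ^+ 3 + a * x + b).
Proof.
rewrite curve_polyE riesz2_horner !(riesz2D, riesz2N, riesz2Z, riesz2_monom).
by ring.
Qed.

(** * Support of a measure *)

Section CountableBase.
Context d (T : measurableType d) (R : realType) (I : countType).
Variable B : I -> set T.
Hypothesis mB : forall i, measurable (B i).

Let seq_cover (J : set I) (n : nat) : set T :=
  if unpickle n is Some i then [set x | J i /\ B i x] else set0.

Let seq_coverE J : \bigcup_n seq_cover J n = \bigcup_(i in J) B i.
Proof.
apply/seteqP; split=> [x [n _]|x [i Ji Bix]].
  by rewrite /seq_cover; case: unpickle => // i [Ji Bix]; exists i.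
by exists (pickle i) => //; rewrite /seq_cover pickleK.
Qed.

Lemma measurable_countable_union (J : set I) :
  measurable (\bigcup_(i in J) B i).
Proof.
rewrite -seq_coverE; apply: bigcupT_measurable => n; rewrite /seq_cover.
case: unpickle => // i; have [Ji|nJi] := pselect (J i).
  by rewrite (_ : [set _ | _] = B i)//; apply/seteqP; split=> [x []|x].
by rewrite (_ : [set _ | _] = set0)//; apply/seteqP; split=> [x []|x].
Qed.

Lemma null_countable_union (mu : {measure set T -> \bar R}) (J : set I) :
  (forall i, J i -> mu (B i) = 0%E) -> mu (\bigcup_(i in J) B i) = 0%E.
Proof.
move=> muB; apply/negligibleP; first exact: measurable_countable_union.
rewrite -seq_coverE; apply: negligible_bigcup => n; rewrite /seq_cover.
case: unpickle => [i|]; last exact: negligible_set0.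
have [Ji|nJi] := pselect (J i).
  have /negligibleP : mu (B i) = 0%E by exact: muB.
  by move=> /(_ (mB i)); apply: negligibleS => x [].
rewrite (_ : [set _ | _] = set0); first exact: negligible_set0.
by apply/seteqP; split=> [x []|x].
Qed.

(* [T] carries no topology here; [op] plays the role of its open sets. *)
Variable op : set T -> Prop.
Hypothesis base : forall U x, op U -> U x -> exists2 i, B i x & B i `<=` U.

Lemma measurable_base_open U : op U -> measurable U.
Proof.
move=> oU; rewrite (_ : U = \bigcup_(i in [set i | B i `<=` U]) B i).
  exact: measurable_countable_union.
apply/seteqP; split=> [x /(base oU)[i Bix BiU]|x [i BiU /BiU//]].
by exists i.
Qed.

(** Lindelöf argument: every point of [W] lies in a null base set, and there are countably many of
    these. *)
Lemma null_locally_null (mu : {measure set T -> \bar R}) (W : set T) :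
  op W ->
  (forall x, W x -> exists U, [/\ op U, U x & ~ (0 < mu U)%E]) ->
  mu W = 0%E.
Proof.
move=> oW W0; apply/eqP; rewrite eq_le measure_ge0 andbT.
pose J := [set i | mu (B i) = 0%E].
rewrite -(@null_countable_union mu J)//; apply: le_measure.
- by rewrite inE; exact: measurable_base_open.
- by rewrite inE; exact: measurable_countable_union.
move=> x /W0[U [oU Ux /negP]]; rewrite -leNgt => U0.
have [i Bix BiU] := base oU Ux; exists i => //; apply/eqP.
rewrite /J/= eq_le measure_ge0 andbT (le_trans _ U0)//.
by apply: le_measure => //; rewrite inE//; exact: measurable_base_open.
Qed.

End CountableBase.

Section Support.
Variable R : realType.

Let ratball (i : rat * rat) : set R := ball (ratr i.1 : R) (ratr i.2).

Let measurable_ratball i : measurable (ratball i).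
Proof. exact: measurable_ball. Qed.

Let base_line (U : set R) x :
  open U -> U x -> exists2 i, ratball i x & ratball i `<=` U.
Proof.
move=> oU /mem_set /(open_subball_rat oU)[c [r /= [/set_mem xB BU]]].
by exists (c, r).
Qed.

Let ratbox (i : (rat * rat) * (rat * rat)) : set (R * R) :=
  ratball i.1 `*` ratball i.2.

Let measurable_ratbox i : measurable (ratbox i).
Proof. exact: measurableX. Qed.

Let base_plane (U : set (R * R)) x :
  open U -> U x -> exists2 i, ratbox i x & ratbox i `<=` U.
Proof.
rewrite openE => oU /oU [[A1 A2] /= [nA1 nA2] AU].
(* The product topology yields neighbourhoods [A1] and [A2] that may fail to be open; their
   interiors are used instead. *)
have [i1 x1 i1A] := base_line (open_interior A1) nA1.
have [i2 x2 i2A] := base_line (open_interior A2) nA2.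
exists (i1, i2) => // y [/i1A/interior_subset y1 /i2A/interior_subset y2].
exact: AU.
Qed.

Lemma open_plane_measurable (U : set (R * R)) : open U -> measurable U.
Proof. exact: (measurable_base_open measurable_ratbox base_plane). Qed.

(** A point outside the support has an open neighbourhood without mass, and second countability
    glues these. Conversely, the null complement of [K] is itself such a neighbourhood. *)
Lemma msupport_subP (mu : {measure set R -> \bar R}) (K : set R) :
  closed K -> msupport mu `<=` K <-> mu (~` K) = 0%E.
Proof.
move=> cK; have oK : open (~` K) by rewrite openC.
split=> [muK|mu0 x mux].
  apply: (null_locally_null measurable_ratball base_line oK) => x nKx.
  have /existsNP[U /not_implyP[oU /not_implyP[Ux muU]]] :=
    contra_not (@muK x) nKx.
  by exists U.
by apply: contrapT => nKx; have := mux _ oK nKx; rewrite mu0 ltxx.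
Qed.

Lemma msupport_plane_subP (mu : {measure set (R * R) -> \bar R})
    (K : set (R * R)) :
  closed K -> msupport mu `<=` K <-> mu (~` K) = 0%E.
Proof.
move=> cK; have oK : open (~` K) by rewrite openC.
split=> [muK|mu0 x mux].
  apply: (null_locally_null measurable_ratbox base_plane oK) => x nKx.
  have /existsNP[U /not_implyP[oU /not_implyP[Ux muU]]] :=
    contra_not (@muK x) nKx.
  by exists U.
by apply: contrapT => nKx; have := mux _ oK nKx; rewrite mu0 ltxx.
Qed.

End Support.

(** * Moments under images of measures *)

(** Integrability is bundled with the value so that both clauses of a representing measure are
    transported at once. *)
Definition moment d (T : measurableType d) (R : realType)
    (mu : {measure set T -> \bar R}) (g : T -> R) (c : R) : Prop :=
  (mu.-integrable setT (fun x => (g x)%:E) /\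
   \int[mu]_x (g x)%:E = c%:E)%E.

Section Moment.
Context d (T : measurableType d) (R : realType).
Variable mu : {measure set T -> \bar R}.

Lemma moment0 : moment mu (fun=> 0) 0.
Proof. by split; [exact: integrable0|exact: integral0]. Qed.

Lemma momentD g h x y :
  moment mu g x -> moment mu h y -> moment mu (fun u => g u + h u) (x + y).
Proof.
move=> [ig eg] [ih eh]; split.
  by under eq_fun do rewrite EFinD; exact: integrableD.
by under eq_integral do rewrite EFinD; rewrite integralD// eg eh.
Qed.

Lemma momentZ c g x : moment mu g x -> moment mu (fun u => c * g u) (c * x).
Proof.
move=> [ig eg]; split.
  by under eq_fun do rewrite EFinM; exact: integrableZl.
by under eq_integral do rewrite EFinM; rewrite integralZl// eg.
Qed.

(** Exchanges integrands that agree only on the set carrying the measure, such as x^(i + 3 j) and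
    x^i z^j on the graph of the cube. *)
Lemma moment_ae (K : set T) (g h : T -> R) c :
  measurable K -> mu (~` K) = 0%E -> {in K, g =1 h} ->
  measurable_fun setT g -> measurable_fun setT h ->
  moment mu g c -> moment mu h c.
Proof.
move=> mK mu0 gh mg mh [ig eg].
have /measurable_EFinP mgE := mg; have /measurable_EFinP mhE := mh.
have ae : ae_eq mu setT (EFin \o g) (EFin \o h).
  exists (~` K); split => //; first exact: measurableC.
  by move=> x /= ngh Kx; apply: ngh => _; rewrite gh// inE.
split; last by rewrite -eg; apply/esym/ae_eq_integral.
apply/integrableP; split => //.
have [_] := integrableP _ _ _ ig; apply: le_lt_trans.
rewrite le_eqVlt; apply/orP; left; apply/eqP/esym/ae_eq_integral => //.
- exact: measurableT_comp.
- exact: measurableT_comp.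
- exact: ae_eq_abse.
Qed.

End Moment.

(** Collects what each change of variables needs from the image measure: its formula, its moments
    and the set that carries it. *)
Lemma pushforward_exists d1 d2 (T1 : measurableType d1) (T2 : measurableType d2)
    (R : realType) (f : T1 -> T2) (mu : {measure set T1 -> \bar R}) :
  measurable_fun setT f ->
  exists nu : {measure set T2 -> \bar R}, [/\ is_pushforward f mu nu,
    forall (g : T2 -> R) c, measurable_fun setT g ->
      moment mu (g \o f) c -> moment nu g c &
    forall K1 K2, measurable K1 -> measurable K2 ->
      (forall x, K1 x -> K2 (f x)) -> mu (~` K1) = 0%E -> nu (~` K2) = 0%E].
Proof.
move=> mf; unshelve eexists (pushforward mu f); [exact: mf|].
split => //.
- move=> g c mg [ig eg]; have mgE := (measurable_EFinP setT g).2 mg.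
  by split; [exact: (integrable_pushforward mf)
            |rewrite (integral_pushforward mf)].
- move=> K1 K2 mK1 mK2 K12 mu0; apply/eqP; rewrite eq_le measure_ge0 andbT.
  change (mu (f @^-1` (~` K2)) <= 0)%E.
  rewrite -mu0; apply: le_measure; rewrite ?inE.
  + by rewrite -[X in measurable X]setTI; apply: mf => //; exact: measurableC.
  + exact: measurableC.
  + by move=> x /= nK2 /K12.
Qed.

Lemma integrable_mscale d (T : measurableType d) (R : realType)
    (mu : {measure set T -> \bar R}) (k : {nonneg R}) (f : T -> \bar R) :
  mu.-integrable setT f -> (mscale k mu).-integrable setT f.
Proof.
move=> /integrableP[mf fi]; apply/integrableP; split => //.
rewrite ge0_integral_mscale//; last exact: measurableT_comp.
by apply: lte_mul_pinfty => //; exact: integral_ge0.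
Qed.

Lemma integral_mscale d (T : measurableType d) (R : realType)
    (mu : {measure set T -> \bar R}) (k : {nonneg R}) (f : T -> \bar R) :
  mu.-integrable setT f ->
  (\int[mscale k mu]_x f x = k%:num%:E * \int[mu]_x f x)%E.
Proof.
move=> fi; have mf := measurable_int _ fi.
rewrite [LHS]integralE [in RHS]integralE !ge0_integral_mscale//.
(* The scalar distributes over the difference because the negative part has finite integral. *)
- rewrite [in RHS]muleBr// fin_num_adde_defl// fin_numN.
  exact: integrable_neg_fin_num.
- exact: measurable_funeneg.
- exact: measurable_funepos.
Qed.

Lemma integrable_measure_add d (T : measurableType d) (R : realType)
    (mu nu : {measure set T -> \bar R}) (f : T -> \bar R) :
  mu.-integrable setT f -> nu.-integrable setT f ->
  (measure_add mu nu).-integrable setT f.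
Proof.
move=> /integrableP[mf fi] /integrableP[_ fi']; apply/integrableP; split => //.
rewrite ge0_integral_measure_add//; last exact: measurableT_comp.
exact: lte_add_pinfty.
Qed.

(** Half the sum of the images under the two square-root branches. [Num.sqrt] is 0 on negative
    numbers, so both branches are total and no sign condition on [nu] enters yet. *)
Lemma symmetric_lift_exists (R : realType)
    (nu : {measure set (R * R) -> \bar R}) :
  exists mu : {measure set (R * R) -> \bar R}, [/\ is_symmetric_lift nu mu,
    forall (g : R * R -> R) c1 c2, measurable_fun setT g ->
      moment nu (fun u => g (u.1, Num.sqrt u.2)) c1 ->
      moment nu (fun u => g (u.1, - Num.sqrt u.2)) c2 ->
      moment mu g (2^-1 * (c1 + c2)) &
    forall K1 K2 : set (R * R), measurable K1 -> measurable K2 ->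
      (forall u, K1 u -> K2 (u.1, Num.sqrt u.2) /\ K2 (u.1, - Num.sqrt u.2)) ->
      nu (~` K1) = 0%E -> mu (~` K2) = 0%E].
Proof.
have msq : measurable_fun setT (fun u : R * R => Num.sqrt u.2).
  apply: (measurableT_comp _ measurable_snd).
  by apply: continuous_measurable_fun; exact: sqrt_continuous.
have mp : measurable_fun setT (fun u : R * R => (u.1, Num.sqrt u.2)).
  exact: measurable_fun_pair.
have mm : measurable_fun setT (fun u : R * R => (u.1, - Num.sqrt u.2)).
  by apply: measurable_fun_pair => //; exact: measurable_funN.
have [nu1 [p1 g1 K1]] := pushforward_exists nu mp.
have [nu2 [p2 g2 K2]] := pushforward_exists nu mm.
have half0 : (0 : R) <= 2^-1 by rewrite invr_ge0.
pose mu : {measure set (R * R) -> \bar R} :=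
  mscale (NngNum half0) (measure_add nu1 nu2).
have muE A : mu A = ((2^-1)%:E * (nu1 A + nu2 A))%E.
  by congr (_ * _)%E; exact: measure_addE.
exists mu; split.
- by move=> A mA; rewrite muE p1// p2.
- move=> g c1 c2 mg /(g1 _ _ mg)[i1 e1] /(g2 _ _ mg)[i2 e2].
  have i12 := integrable_measure_add i1 i2.
  split; first exact: integrable_mscale.
  by rewrite integral_mscale// integral_measure_add// e1 e2.
- move=> L1 L2 mL1 mL2 L12 nu0; rewrite muE.
  rewrite (K1 L1 L2)// ?(K2 L1 L2)// ?adde0 ?mule0//.
  + by move=> u /L12[].
  + by move=> u /L12[].
Qed.

(** * The closed sets carrying the measures *)

Section Sets.
Variables (R : realType) (a b : R).

Local Notation f x := (x ^+ 3 + a * x + b).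

Lemma curveE : curve a b = [set u | u.2 ^+ 2 = f u.1].
Proof.
apply/seteqP; split=> u; rewrite /curve /mkset horner_curve.
  by move/subr0_eq.
by move=> ->; rewrite subrr.
Qed.

Lemma phi_K_tildeE :
  phi a b @` K_tilde a b = [set u | 0 <= f u.1 /\ u.2 = u.1 ^+ 3].
Proof.
apply/seteqP; split=> [_ [[x z] [/= z0 zE] <-]|[x z] [/= fx0 ->]].
  by rewrite /phi/= -zE; split=> //; rewrite zE; ring.
by exists (x, f x) => //=; rewrite /phi/=; congr (_, _); ring.
Qed.

Lemma fst_K_tildeE : fst @` K_tilde a b = [set x | 0 <= f x].
Proof.
apply/seteqP; split=> [_ [[x z] [/= z0 zE] <-]|x fx0]; first by rewrite -zE.
by exists (x, f x).
Qed.

Lemma fst_phi : fst @` (phi a b @` K_tilde a b) = fst @` K_tilde a b.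
Proof. by rewrite image_comp. Qed.

Lemma E_setE x1 : E_set a b x1 = [set x | 0 <= f (x + x1)].
Proof.
rewrite /E_set fst_phi fst_K_tildeE; apply/seteqP; split=> [_ [y fy <-]|x fx].
  by rewrite /phi_tilde/= subrK.
by exists (x + x1) => //; rewrite /phi_tilde addrK.
Qed.

Lemma phi_K_tilde_graph :
  phi a b @` K_tilde a b = [set (x, x ^+ 3) | x in fst @` K_tilde a b].
Proof.
rewrite phi_K_tildeE fst_K_tildeE.
by apply/seteqP; split=> [[x z] [/= fx ->]|_ [x fx <-]]; first by exists x.
Qed.

(** The cubic factors as (y - x1) g(y). The quadratic g vanishes at most at [x1], hence never
    changes sign, and the sign of the cubic is that of y - x1. *)
Lemma E_set_one_root x1 : root (cubic a b) x1 ->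
  (forall x, root (cubic a b) x -> x = x1) -> E_set a b x1 = `[0, +oo[%classic.
Proof.
rewrite root_cubic => /eqP r1 uniq; rewrite E_setE.
pose g y := y ^+ 2 + x1 * y + (x1 ^+ 2 + a).
have fE y : f y = (y - x1) * g y by rewrite -[LHS]subr0 -r1 /g; ring.
have rootg y : g y = 0 -> y = x1.
  by move=> gy; apply: uniq; rewrite root_cubic fE gy mulr0.
have g0 y : 0 <= g y.
  (* [D] is the discriminant of g; completing the square settles the case where it is not
     positive. *)
  pose D := - 3 * x1 ^+ 2 - 4 * a.
  have gE : 4 * g y = (2 * y + x1) ^+ 2 - D by rewrite /g /D; ring.
  have [D0|D0] := leP D 0; first by have := sqr_ge0 (2 * y + x1); lra.
  have sD := sqr_sqrtr (ltW D0).
  have root s : s ^+ 2 = D -> (s - x1) / 2 = x1.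
    move=> sE; apply: rootg.
    have -> : g ((s - x1) / 2) = (s ^+ 2 - D) / 4 by rewrite /g /D; field.
    by rewrite sE subrr mul0r.
  (* For positive [D] both roots of g would equal [x1], forcing the square root of [D] to be
     zero. *)
  have := root _ sD; have := root (- Num.sqrt D); rewrite sqrrN => /(_ sD).
  by have := D0; rewrite -sqrtr_gt0; lra.
apply/seteqP; split=> x /=; rewrite in_itv/= andbT fE addrK => x0.
  rewrite leNgt; apply/negP => x_lt0.
  have gx : g (x + x1) = 0.
    apply/eqP; rewrite eq_le g0 andbT; move: x0; rewrite nmulr_rge0//.
  by have := rootg _ gx; lra.
by rewrite mulr_ge0.
Qed.

Lemma E_set_three_roots x1 x2 x3 :
  root (cubic a b) x1 -> root (cubic a b) x2 -> root (cubic a b) x3 ->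
  x1 < x2 -> x2 < x3 ->
  E_set a b x1 = `[0, x2 - x1]%classic `|` `[x3 - x1, +oo[%classic.
Proof.
rewrite !root_cubic => /eqP r1 /eqP r2 /eqP r3 x12 x23; rewrite E_setE.
(* Vieta's formulas: the difference of the equations at [x1] and [x2], divided by [x2 - x1], gives
   [a]; comparing [x3] with [x1] then shows that the roots sum to zero. *)
have aE : a = - (x1 ^+ 2 + x1 * x2 + x2 ^+ 2).
  have /eqP : (x2 - x1) * (a + (x1 ^+ 2 + x1 * x2 + x2 ^+ 2)) = 0.
    by rewrite -[RHS](subrr 0) -{1}r2 -r1; ring.
  by rewrite mulf_eq0 subr_eq0 gt_eqF//= => /eqP; lra.
have x3E : x3 = - x1 - x2.
  have /eqP : (x3 - x1) * ((x3 - x2) * (x1 + x2 + x3)) = 0.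
    by rewrite -[RHS](subrr 0) -{1}r3 -r1 aE; ring.
  rewrite !mulf_eq0 !subr_eq0 (gt_eqF x23) (gt_eqF (lt_trans x12 x23))/=.
  by move=> /eqP; lra.
have fE y : f y = (y - x1) * (y - x2) * (y - x3).
  by rewrite -[LHS]subr0 -r1 aE x3E; ring.
apply/seteqP; split=> x /=; rewrite !in_itv/= !andbT fE addrK.
  (* Below the largest root the last factor is negative, so the product of the other two is at most
     0, which confines x to the bounded interval. *)
  move=> fx; have [xx3|xx3] := leP (x3 - x1) x; first by right.
  have {}fx : x * (x + x1 - x2) <= 0.
    by move: fx; rewrite nmulr_lge0//; lra.
  left; apply/andP; split; rewrite leNgt; apply/negP => H.
    by move: fx; rewrite leNgt nmulr_rgt0//; lra.
  by move: fx; rewrite leNgt pmulr_rgt0//; lra.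
move=> [/andP[x0 xx2]|xx3]; last by rewrite !mulr_ge0//; lra.
rewrite -mulrA mulr_ge0// mulr_le0//; lra.
Qed.

Let continuous_f : continuous (fun x : R => f x).
Proof.
move=> x; apply: cvgD; last exact: cvg_cst.
apply: cvgD; first exact: exprn_continuous.
by apply: cvgM; [exact: cvg_cst|exact: cvg_id].
Qed.

Let continuous_f1 : continuous (fun u : R * R => f u.1).
Proof.
move=> u; apply: (@continuous_comp (R * R)%type R R fst (fun x => f x)).
  exact: cvg_fst.
exact: continuous_f.
Qed.

Let closed_preimage (T : topologicalType) (g : T -> R) (D : set R) :
  continuous g -> closed D -> closed (g @^-1` D).
Proof. by move=> cg; apply: preimage_closed => x _; exact: cg. Qed.

Let closed_ge0 : closed [set y : R | 0 <= y].
Proof. exact: closed_ge. Qed.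

Let closed_zero : closed [set 0 : R].
Proof. exact: closed_eq. Qed.

Lemma closed_fst_K_tilde : closed (fst @` K_tilde a b).
Proof.
rewrite fst_K_tildeE; exact: (closed_preimage continuous_f closed_ge0).
Qed.

Lemma closed_E_set x1 : closed (E_set a b x1).
Proof.
rewrite E_setE; apply: (closed_preimage (g := fun x => f (x + x1))) closed_ge0.
move=> x; apply: (@continuous_comp R R R (fun x => x + x1) (fun x => f x)).
  by apply: cvgD; [exact: cvg_id|exact: cvg_cst].
exact: continuous_f.
Qed.

Lemma closed_curve : closed (curve a b).
Proof.
rewrite curveE (_ : [set _ | _] = (fun u => u.2 ^+ 2 - f u.1) @^-1` [set 0]).
  apply: closed_preimage closed_zero => u.
  apply: cvgB; last exact: continuous_f1.
  apply: (@continuous_comp (R * R)%type R R snd (fun y => y ^+ 2)).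
    exact: cvg_snd.
  exact: exprn_continuous.
by apply/seteqP; split=> u /=; [move=> ->; rewrite subrr|move/subr0_eq].
Qed.

Lemma closed_K_tilde : closed (K_tilde a b).
Proof.
rewrite (_ : K_tilde a b = snd @^-1` [set y | 0 <= y] `&`
  (fun u => u.2 - f u.1) @^-1` [set 0]).
  apply: closedI.
    by apply: closed_preimage closed_ge0 => u; exact: cvg_snd.
  apply: closed_preimage closed_zero => u.
  by apply: cvgB; [exact: cvg_snd|exact: continuous_f1].
apply/seteqP; split=> u /= [u0 uE]; split=> //; last exact: subr0_eq.
by rewrite uE subrr.
Qed.

Lemma closed_phi_K_tilde : closed (phi a b @` K_tilde a b).
Proof.
rewrite phi_K_tildeE.
rewrite (_ : [set _ | _] = (fun u => f u.1) @^-1` [set y | 0 <= y] `&`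
  (fun u => u.2 - u.1 ^+ 3) @^-1` [set 0]).
  apply: closedI; first exact: closed_preimage closed_ge0.
  apply: closed_preimage closed_zero => u; apply: cvgB; first exact: cvg_snd.
  apply: (@continuous_comp (R * R)%type R R fst (fun y => y ^+ 3)).
    exact: cvg_fst.
  exact: exprn_continuous.
apply/seteqP; split=> u /= [u0 uE]; split=> //; last exact: subr0_eq.
by rewrite uE subrr.
Qed.

End Sets.

(** * Transfer of representing measures *)

Lemma measurable_monom_plane (R : realType) (i j : nat) :
  measurable_fun setT (fun u : R * R => u.1 ^+ i * u.2 ^+ j).
Proof.
apply: measurable_funM; apply: measurable_funX.
  exact: measurable_fst.
exact: measurable_snd.
Qed.

Lemma moment_riesz (R : realType) (mu : {measure set R -> \bar R}) (N : nat)
    (s : nat -> R) :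
  (forall t, (t <= N)%N -> moment mu (fun x : R => x ^+ t) (s t)) ->
  forall q : {poly R}, (size q <= N.+1)%N ->
    moment mu (fun x : R => q.[x]) (riesz s q).
Proof.
move=> mus; apply: poly_linear_ind.
- by under eq_fun do rewrite horner0; rewrite riesz0; exact: moment0.
- move=> p q Hp Hq; under eq_fun do rewrite hornerD.
  by rewrite rieszD; exact: momentD.
- move=> c t tN; under eq_fun do rewrite hornerZ hornerXn.
  by rewrite rieszZ rieszXn; exact/momentZ/mus.
Qed.

Lemma moment_riesz2 (R : realType) (mu : {measure set (R * R) -> \bar R})
    (I : nat -> nat -> Prop) (s : nat -> nat -> R) :
  (forall i j, I i j ->
    moment mu (fun u : R * R => u.1 ^+ i * u.2 ^+ j) (s i j)) ->
  forall q : {poly {poly R}}, support_in I q ->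
    moment mu (fun u : R * R => q.[u.1, u.2]) (riesz2 s q).
Proof.
move=> mus; apply: bipoly_linear_ind.
- by under eq_fun do rewrite !horner0; rewrite riesz20; exact: moment0.
- move=> p q Hp Hq; under eq_fun do rewrite !hornerD.
  by rewrite riesz2D; exact: momentD.
- move=> c i j Iij.
  under eq_fun do rewrite riesz2_horner riesz2Z riesz2_monom.
  by rewrite riesz2Z riesz2_monom; exact/momentZ/mus.
Qed.

Section Transformations.
Variables (R : realType) (n : nat) (a b : R) (beta : nat -> nat -> R).

Let rep_tilde := represents2 (weighted_index n) (beta_tilde beta) (K_tilde a b).
Let rep_hat :=
  represents2 (weighted_index n) (beta_hat a b beta) (phi a b @` K_tilde a b).
Let rep_gamma :=
  represents (3 * n) (gamma a b beta) (fst @` (phi a b @` K_tilde a b)).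

Let closed_measurable_plane (K : set (R * R)) : closed K -> measurable K.
Proof.
move=> cK; rewrite -[K]setCK; apply: measurableC; apply: open_plane_measurable.
by rewrite openC.
Qed.

Let mcurve := closed_measurable_plane (@closed_curve R a b).
Let mtilde := closed_measurable_plane (@closed_K_tilde R a b).
Let mhat := closed_measurable_plane (@closed_phi_K_tilde R a b).

Let closed_line : closed (fst @` (phi a b @` K_tilde a b)).
Proof. by rewrite fst_phi; exact: closed_fst_K_tilde. Qed.

Let mline := closed_measurable closed_line.
Let mE x1 := closed_measurable (@closed_E_set R a b x1).

Lemma tilde_of_beta mu :
  represents2 (deg_index n) beta (curve a b) mu -> exists nu, rep_tilde nu /\
    is_pushforward (fun u : R * R => (u.1, u.2 ^+ 2)) mu nu.
Proof.
move=> [/(msupport_plane_subP _ (@closed_curve _ a b)) mu0 mus].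
have mf : measurable_fun setT (fun u : R * R => (u.1, u.2 ^+ 2)).
  by apply: measurable_fun_pair => //; apply: measurable_funX.
have [nu [nuE mom supp]] := pushforward_exists mu mf.
exists nu; split=> //; split.
  apply/(msupport_plane_subP _ (@closed_K_tilde _ a b)).
  apply: supp mu0 => //; rewrite curveE => u /= uE.
  by split; [exact: sqr_ge0|].
move=> i j ij; apply: mom; first exact: measurable_monom_plane.
rewrite (_ : _ \o _ = fun u : R * R => u.1 ^+ i * u.2 ^+ (2 * j)).
  exact: mus.
by apply/funext => u /=; rewrite exprM.
Qed.

Lemma hat_of_tilde mu :
  rep_tilde mu -> exists nu, rep_hat nu /\ is_pushforward (phi a b) mu nu.
Proof.
move=> [/(msupport_plane_subP _ (@closed_K_tilde _ a b)) mu0 mus].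
have mf : measurable_fun setT (phi a b).
  apply: measurable_fun_pair => //; apply: measurable_funB => //.
  by apply: measurable_funB => //; apply: measurable_funM.
have [nu [nuE mom supp]] := pushforward_exists mu mf.
exists nu; split=> //; split.
  apply/(msupport_plane_subP _ (@closed_phi_K_tilde _ a b)).
  by apply: supp mu0 => // u Ku; exists u.
move=> i j ij; apply: mom; first exact: measurable_monom_plane.
pose q : {poly {poly R}} := 'X^i * ('Y - a%:P%:P * 'X - b%:P%:P) ^+ j.
rewrite (_ : _ \o _ = fun u : R * R => q.[u.1, u.2]).
  apply: (moment_riesz2 mus); rewrite /q -monomX.
  apply: (@wdeg_leW _ 2 _ (2 * n)); last first.
    by apply: wdeg_leM; [exact: wdeg_le_monom|apply/wdeg_leX/wdeg_le_w].
  by move: ij; rewrite /weighted_index/=; lia.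
by apply/funext => u; rewrite /q /phi/= !hornerE.
Qed.

Lemma tilde_of_hat mu :
  rep_hat mu -> exists nu, rep_tilde nu /\ is_pushforward (phi_inv a b) mu nu.
Proof.
move=> [/(msupport_plane_subP _ (@closed_phi_K_tilde _ a b)) mu0 mus].
have mf : measurable_fun setT (phi_inv a b).
  apply: measurable_fun_pair => //; apply: measurable_funD => //.
  by apply: measurable_funD => //; apply: measurable_funM.
have [nu [nuE mom supp]] := pushforward_exists mu mf.
exists nu; split=> //; split.
  apply/(msupport_plane_subP _ (@closed_K_tilde _ a b)).
  apply: supp mu0 => // _ [u Ku <-]; rewrite (_ : phi_inv a b _ = u)//.
  by case: u {Ku} => x z; rewrite /phi_inv /phi/=; congr (_, _); ring.
move=> i j ij; apply: mom; first exact: measurable_monom_plane.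
pose q : {poly {poly R}} := 'X^i * ('Y + a%:P%:P * 'X + b%:P%:P) ^+ j.
rewrite -(riesz2_beta_hat_inv a b) (_ : _ \o _ = fun u : R * R => q.[u.1, u.2]).
  apply: (moment_riesz2 mus); rewrite /q -monomX.
  apply: (@wdeg_leW _ 2 _ (2 * n)); last first.
    apply: wdeg_leM; first exact: wdeg_le_monom.
    (* The inverse substitution is [w] with [a] and [b] negated, so the same weight bound serves. *)
    apply/wdeg_leX; have := @wdeg_le_w R (- a) (- b).
    rewrite !polyCN mulNr !opprK. exact.
  by move: ij; rewrite /weighted_index/=; lia.
by apply/funext => u; rewrite /q /phi_inv/= !hornerE.
Qed.

Lemma gamma_of_hat mu :
  rep_hat mu -> exists nu, rep_gamma nu /\
    is_pushforward (fst : R * R -> R) mu nu.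
Proof.
move=> [/(msupport_plane_subP _ (@closed_phi_K_tilde _ a b)) mu0 mus].
have [nu [nuE mom supp]] := pushforward_exists mu (@measurable_fst _ _ R R).
exists nu; split=> //; split.
  apply/(msupport_subP _ closed_line).
  by apply: supp mu0 => // u Ku; exists u.
move=> t tn; apply: mom; first exact: exprn_measurable.
apply: (moment_ae mhat mu0); last first.
(* Taking the remainder below 3 keeps this pair in the weighted index set for every [t] up to
   [3 * n]. *)
- by apply: (mus (t %% 3)%N (t %/ 3)%N); rewrite /weighted_index/=; lia.
- by apply: measurable_funX.
- exact: measurable_monom_plane.
move=> u; rewrite inE phi_K_tildeE => -[/= _ ->].
by rewrite -exprM -exprD addnC mulnC -divn_eq.
Qed.

(** Along the graph x^i z^j becomes x^(i + 3 j), whatever the size of i, so consistency of [gamma]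
    over all representations of an exponent is what makes the moments match. *)
Lemma hat_of_gamma mu :
  (forall i j, (i + 2 * j <= 2 * n)%N ->
    gamma a b beta (i + 3 * j)%N = beta_hat a b beta i j) ->
  rep_gamma mu -> exists nu, rep_hat nu /\
    is_pushforward (fun x : R => (x, x ^+ 3)) mu nu.
Proof.
move=> gE [/(msupport_subP _ closed_line) mu0 mus].
have mf : measurable_fun setT (fun x : R => (x, x ^+ 3)).
  by apply: measurable_fun_pair => //; exact: exprn_measurable.
have [nu [nuE mom supp]] := pushforward_exists mu mf.
exists nu; split=> //; split.
  apply/(msupport_plane_subP _ (@closed_phi_K_tilde _ a b)).
  apply: supp mu0 => // x; rewrite fst_phi fst_K_tildeE phi_K_tildeE.
  by [].
move=> i j ij; apply: mom; first exact: measurable_monom_plane.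
rewrite -gE// (_ : _ \o _ = fun x : R => x ^+ (i + 3 * j)).
  by apply: mus; move: ij; rewrite /weighted_index/=; lia.
by apply/funext => x /=; rewrite exprD exprM.
Qed.

Lemma gamma_tilde_of_gamma x1 mu :
  rep_gamma mu -> exists nu,
    represents (3 * n) (gamma_tilde a b x1 beta) (E_set a b x1) nu /\
    is_pushforward (phi_tilde x1) mu nu.
Proof.
move=> [/(msupport_subP _ closed_line) mu0 mus].
have mf : measurable_fun setT (phi_tilde x1) by exact: measurable_funB.
have [nu [nuE mom supp]] := pushforward_exists mu mf.
exists nu; split=> //; split.
  apply/(msupport_subP _ (@closed_E_set _ a b x1)).
  by apply: (supp _ _ mline (mE x1) _ mu0) => x Kx; exists x.
move=> t tn; apply: mom; first exact: exprn_measurable.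
rewrite (_ : _ \o _ = fun x : R => (('X - x1%:P) ^+ t).[x]).
  by apply: (moment_riesz mus); rewrite size_exp_XsubC.
by apply/funext => x; rewrite /phi_tilde/= !hornerE.
Qed.

Lemma gamma_of_gamma_tilde x1 mu :
  represents (3 * n) (gamma_tilde a b x1 beta) (E_set a b x1) mu ->
  exists nu, rep_gamma nu /\ is_pushforward (fun x : R => x + x1) mu nu.
Proof.
move=> [/(msupport_subP _ (@closed_E_set _ a b x1)) mu0 mus].
have mf : measurable_fun setT (fun x : R => x + x1) by exact: measurable_funD.
have [nu [nuE mom supp]] := pushforward_exists mu mf.
exists nu; split=> //; split.
  apply/(msupport_subP _ closed_line).
  apply: (supp _ _ (mE x1) mline _ mu0) => x.
  by rewrite fst_phi fst_K_tildeE E_setE.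
move=> t tn; apply: mom; first exact: exprn_measurable.
rewrite -(riesz_gamma_tilde_inv _ _ x1).
rewrite (_ : _ \o _ = fun x : R => (('X + x1%:P) ^+ t).[x]).
  apply: (moment_riesz mus).
  by rewrite -[x1%:P]opprK -polyCN size_exp_XsubC.
by apply/funext => x; rewrite /= !hornerE.
Qed.

(* Both monomials on the right are even in each variable, and of degree at most
   [2 n] as soon as [i + j <= 2 n]. *)
Lemma monom_even_bound i j (x r : R) : odd j -> 0 <= r ->
  `|x ^+ i * r ^+ j| <=
  x ^+ (uphalf i).*2 * r ^+ j.-1 + x ^+ (i./2).*2 * r ^+ j.+1.
Proof.
move=> oj r0; rewrite normrM !normrX (ger0_norm r0).
have xe m : x ^+ m.*2 = `|x| ^+ m.*2.
  by rewrite -mul2n !exprM real_normK ?num_real.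
rewrite !xe; move: (`|x|) (normr_ge0 x) => {xe}y y0.
case: j oj => //= j _; rewrite !exprS.
set P := r ^+ j; have P0 : 0 <= P by exact: exprn_ge0.
rewrite -{1}(odd_double_half i) uphalf_half exprD doubleD exprD.
set Y := y ^+ (i./2).*2; have Y0 : 0 <= Y by exact: exprn_ge0.
have YP0 : 0 <= Y * P by exact: mulr_ge0.
(* After the common factor [Y * P] is removed, what remains is y^2 - y r + r^2 for odd [i] and 1 - r
   + r^2 for even [i], each a square plus a nonnegative term. *)
case: (odd i); rewrite /= ?expr1 ?expr0 -subr_ge0.
  rewrite (_ : _ - _ = Y * P * ((y - r) ^+ 2 + y * r)); last by ring.
  by rewrite mulr_ge0// addr_ge0// ?sqr_ge0// mulr_ge0.
rewrite (_ : _ - _ = Y * P * ((1 - r) ^+ 2 + r)); last by ring.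
by rewrite mulr_ge0// addr_ge0// sqr_ge0.
Qed.

Lemma beta_of_tilde mu :
  (forall i j, (i + j <= 2 * n)%N -> odd j -> beta i j = 0) ->
  rep_tilde mu -> exists nu,
    represents2 (deg_index n) beta (curve a b) nu /\ is_symmetric_lift mu nu.
Proof.
move=> beta_odd [/(msupport_plane_subP _ (@closed_K_tilde _ a b)) mu0 mus].
have [nu [nuE mom supp]] := symmetric_lift_exists mu.
exists nu; split=> //; split.
  apply/(msupport_plane_subP _ (@closed_curve _ a b)).
  apply: supp mu0 => // u [u0 uE]; rewrite curveE /= sqrrN sqr_sqrtr//.
pose g i j (u : R * R) := u.1 ^+ i * Num.sqrt u.2 ^+ j.
have mg i j : measurable_fun setT (g i j).
  apply: measurable_funM; apply: measurable_funX; first exact: measurable_fst.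
  apply: (measurableT_comp _ measurable_snd).
  by apply: continuous_measurable_fun; exact: sqrt_continuous.
(* For even [j] the root disappears on the carrier, where z is nonnegative, and the integrand
   becomes x^i z^(j/2). *)
have even_moment i j : (i + j <= 2 * n)%N -> ~~ odd j ->
    moment mu (g i j) (beta i j).
  move=> ij ej; have jE : j = (2 * j./2)%N.
    by rewrite -[LHS]odd_double_half (negPf ej) mul2n.
  have iw : (i + 2 * j./2 <= 2 * n)%N by rewrite -jE.
  rewrite {2}jE; apply: (moment_ae mtilde mu0) (mus _ _ iw) => //.
    by move=> u; rewrite inE => -[u0 _]; rewrite /g jE exprM sqr_sqrtr// -jE.
  exact: measurable_monom_plane.
move=> i j; rewrite /deg_index/= => ij.
have [oj|ej] := boolP (odd j); last first.
  rewrite (_ : beta i j = 2^-1 * (beta i j + beta i j)); last by field.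
  apply: mom; [exact: measurable_monom_plane|exact: even_moment|].
  rewrite (_ : (fun u => _) = g i j); first exact: even_moment.
  by apply/funext => u; rewrite /g /= exprNn -signr_odd (negPf ej) mul1r.
(* Odd powers of the root are not polynomial in z; their integrability comes from domination by two
   even moments, and the value [c] itself stays unknown. *)
have [c gc] : exists c, moment mu (g i j) c.
  have [ie _] := momentD
    (even_moment (uphalf i).*2 j.-1 ltac:(lia) ltac:(lia))
    (even_moment (i./2).*2 j.+1 ltac:(lia) ltac:(lia)).
  have ig : mu.-integrable setT (EFin \o g i j).
    apply: le_integrable ie => //; first exact/measurable_EFinP.
    move=> u _; rewrite /= lee_fin; apply: le_trans (ler_norm _).
    exact: monom_even_bound.
  exists (fine (\int[mu]_u (g i j u)%:E)); split=> //.
  by rewrite fineK//; exact: integrable_fin_num.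
(* The two branches contribute [c] and [- c], so their average is the prescribed odd entry 0. *)
rewrite (beta_odd _ _ ij oj) (_ : 0 = 2^-1 * (c + -1 * c)); last by ring.
apply: mom => //; first exact: measurable_monom_plane.
rewrite (_ : (fun u => _) = fun u => -1 * g i j u); first exact: momentZ.
by apply/funext => u; rewrite /g /= exprNn -signr_odd oj expr1 mulrCA.
Qed.

End Transformations.

Theorem proposition5p1 (R : realType) (n : nat) (a b x1 : R)
    (beta : nat -> nat -> R) :
  (3 <= n)%N ->
  psd (moment_matrix n beta) ->
  p_pure n beta (curve_poly a b) ->
  (forall i j : nat, (i + j <= 2 * n)%N -> odd j -> beta i j = 0) ->
  smallest_root a b x1 ->
  let rep_beta :=
    represents2 (deg_index n) beta (curve a b) in
  let rep_beta_tilde :=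
    represents2 (weighted_index n) (beta_tilde beta) (K_tilde a b) in
  let rep_beta_hat :=
    represents2 (weighted_index n) (beta_hat a b beta)
      (phi a b @` K_tilde a b) in
  let rep_gamma :=
    represents (3 * n) (gamma a b beta) (fst @` (phi a b @` K_tilde a b)) in
  let rep_gamma_tilde :=
    represents (3 * n) (gamma_tilde a b x1 beta) (E_set a b x1) in
  [/\ phi a b @` K_tilde a b = [set (x, x ^+ 3) | x in fst @` K_tilde a b],
      (forall i j : nat, (i + 2 * j <= 2 * n)%N ->
         gamma a b beta (i + 3 * j)%N = beta_hat a b beta i j),
      E_set a b x1 = phi_tilde x1 @` (fst @` K_tilde a b),
      ((forall x : R, root (cubic a b) x -> x = x1) ->
         E_set a b x1 = `[0, +oo[%classic) &
      (forall x2 x3 : R, root (cubic a b) x2 -> root (cubic a b) x3 ->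
         x1 < x2 -> x2 < x3 ->
         E_set a b x1 = `[0, x2 - x1]%classic `|` `[x3 - x1, +oo[%classic)] /\
  ((exists mu, rep_beta mu) <-> (exists mu, rep_gamma_tilde mu)) /\
  [/\ (forall mu, rep_beta mu -> exists nu, rep_beta_tilde nu /\
         is_pushforward (fun u : R * R => (u.1, u.2 ^+ 2)) mu nu),
      (forall mu, rep_beta_tilde mu -> exists nu, rep_beta_hat nu /\
         is_pushforward (phi a b) mu nu),
      (forall mu, rep_beta_hat mu -> exists nu, rep_gamma nu /\
         is_pushforward (fst : R * R -> R) mu nu) &
      (forall mu, rep_gamma mu -> exists nu, rep_gamma_tilde nu /\
         is_pushforward (phi_tilde x1) mu nu)] /\
  [/\ (forall mu, rep_gamma_tilde mu -> exists nu, rep_gamma nu /\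
         is_pushforward (fun x : R => x + x1) mu nu),
      (forall mu, rep_gamma mu -> exists nu, rep_beta_hat nu /\
         is_pushforward (fun x : R => (x, x ^+ 3)) mu nu),
      (forall mu, rep_beta_hat mu -> exists nu, rep_beta_tilde nu /\
         is_pushforward (phi_inv a b) mu nu) &
      (forall mu, rep_beta_tilde mu -> exists nu, rep_beta nu /\
         is_symmetric_lift mu nu)].

Proof.
move=> n3 _ pure beta_odd [root1 _] rb rbt rbh rg rgt.
have gE := gammaE n3 pure.
split; [split|split; [split|split; split]].
- exact: phi_K_tilde_graph.
- exact: gE.
- by rewrite /E_set fst_phi.
- exact: E_set_one_root.
- by move=> x2 x3; exact: E_set_three_roots.
- move=> [mu /tilde_of_beta[mu1 [/hat_of_tilde[mu2 [/gamma_of_hat[mu3 []]]]]]].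
  by move=> /(gamma_tilde_of_gamma x1)[mu4 [r4 _]]; exists mu4.
- move=> [mu /gamma_of_gamma_tilde[mu1 [/(hat_of_gamma gE)[mu2 []]]]].
  move=> /tilde_of_hat[mu3 [/(beta_of_tilde beta_odd)[mu4 [r4 _]]]].
  by exists mu4.
- by move=> mu; exact: tilde_of_beta.
- by move=> mu; exact: hat_of_tilde.
- by move=> mu; exact: gamma_of_hat.
- by move=> mu; exact: gamma_tilde_of_gamma.
- by move=> mu; exact: gamma_of_gamma_tilde.
- by move=> mu; exact: hat_of_gamma.
- by move=> mu; exact: tilde_of_hat.
- by move=> mu; exact: beta_of_tilde.
Qed.
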